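(* Let $(W,I)$ be a Coxeter system and let $J\subset I$ be a subset such that $W_J$ is finite. Then $\mathcal{Q}^J$ is a graded poset, where the rank of $Q_{x,u,w}$ is $\ell(wu)-\ell(x)$.
   Context: $W$ has simple reflections $s_i$, $i\in I$, length function $\ell$ and Bruhat order $\le$. $W_J=\langle s_j : j\in J\rangle$. $W^J$ (resp. $W^J_{max}$) is the set of minimal (resp. maximal) length coset representatives of $W/W_J$. Let $\mathcal{I}^J\subset W^J_{max}\times W_J\times W^J$ be the set of triples $(x,u,w)$ with $x\le wu$. The poset $\mathcal{Q}^J$ has elements $\{\hat 0\}\cup\{Q_{x,u,w} : (x,u,w)\in\mathcal{I}^J\}$ (distinct triples give distinct elements), with order relation: $Q_{x,u,w}\le Q_{x',u',w'}$ if and only if there exist $u_1,u_2\in W_J$ with $u_1u_2=u$ and $\ell(u)=\ell(u_1)+\ell(u_2)$ such that $x'u'^{-1}\le xu_2^{-1}\le wu_1\le w'$; and $\hat 0<Q_{x,u,w}$ for all $Q_{x,u,w}$. A poset is graded if it is finite, has a least element $\hat 0$ and a greatest element $\hat 1$, and all its maximal chains have the same length. The rank of an element of a graded poset is the common length of all unrefinable chains from $\hat 0$ to that element.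
   Formalization: The rank of Q_{x,u,w}, counted from rank 0 at the least element, is proved to be ℓ(wu)−ℓ(x)+1; Q^J is proved graded when W is finite (for infinite W it is infinite, so not graded), and for all W it is a poset whose principal lower ideals are graded. *)

(* Defs.v *)
From mathcomp Require Import all_boot.
From mathcomp Require Import boolp classical_sets functions cardinality.
From Stdlib Require Relation_Operators.

Set Implicit Arguments.
Unset Strict Implicit.
Unset Printing Implicit Defensive.

Local Open Scope classical_set_scope.
Local Open Scope group_scope.

Section Posets.
Variables (T : eqType) (le : rel T).
Implicit Types (A : set T) (a b x y : T) (c : seq T).

Definition partial_order : Prop :=
  [/\ reflexive le, antisymmetric le & transitive le].

Definition slt : rel T := fun x y => (x != y) && le x y.

(* A finite chain [x_0 < ... < x_k] is the list of its elements; its length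
   is k, one less than its number of elements. *)
Definition chain A c : Prop := sorted slt c /\ {in c, forall x, A x}.

Definition maximal_chain A c : Prop :=
  chain A c /\ forall c', chain A c' -> {subset c <= c'} -> {subset c' <= c}.

Definition chain_length c : nat := (size c).-1.

(* The subset [A], with the order induced by [le], is a graded poset. *)
Definition graded A : Prop :=
  [/\ [/\ {in A, reflexive le}, {in A &, antisymmetric le}
        & {in A & &, transitive le}],
      finite_set A,
      exists2 b, A b & forall x, A x -> le b x,
      exists2 t, A t & forall x, A x -> le x t
    & exists n, forall c, maximal_chain A c -> chain_length c = n].

Definition covers : rel T :=
  fun x y => slt x y && `[< forall z, ~~ (slt x z && slt z y) >].

Definition unrefinable_chain a b c : Prop :=
  exists c', [/\ c = a :: c', path covers a c' & last a c' = b].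

(* [n] is the common length of all unrefinable chains from the least element
   [bot] to [x]; thus [bot] has rank 0 and the atoms have rank 1. *)
Definition has_rank bot x (n : nat) : Prop :=
  (exists c, unrefinable_chain bot x c) /\
  forall c, unrefinable_chain bot x c -> chain_length c = n.

End Posets.

Section CoxeterSystems.
Variables (I : Type) (W : groupType) (s : I -> W).

(* The congruence on words generated by [(ij)^(m i j) = 1]. The value
   [m i j = 0] stands for infinity and gives no relation. When [m i i = 1] the
   generators are involutions, so that the monoid presented in this way is the
   group with the same presentation. *)
Inductive coxeter_congr (m : I -> I -> nat) : seq I -> seq I -> Prop :=
| cox_refl r : coxeter_congr m r r
| cox_sym r1 r2 : coxeter_congr m r1 r2 -> coxeter_congr m r2 r1
| cox_trans r1 r2 r3 :
    coxeter_congr m r1 r2 -> coxeter_congr m r2 r3 -> coxeter_congr m r1 r3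
| cox_cat r1 r2 r1' r2' :
    coxeter_congr m r1 r1' -> coxeter_congr m r2 r2' ->
    coxeter_congr m (r1 ++ r2) (r1' ++ r2')
| cox_rel i j : coxeter_congr m (flatten (nseq (m i j) [:: i; j])) [::].

Definition word_prod (r : seq I) : W := \prod_(i <- r) s i.

Definition coxeter_system : Prop :=
  exists m : I -> I -> nat,
    [/\ forall i j, m i j = m j i,
        forall i j, m i j = 1%N <-> i = j,
        forall w, exists r, word_prod r = w
      & forall r1 r2, word_prod r1 = word_prod r2 <-> coxeter_congr m r1 r2].

Definition is_length (w : W) (n : nat) : Prop :=
  (exists2 r, word_prod r = w & size r = n) /\
  forall r, word_prod r = w -> (n <= size r)%N.

Definition len (w : W) : nat := xget 0%N [set n | is_length w n].

Definition reflection (t : W) : Prop := exists i w, t = w * s i * w^-1.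

Definition bruhat_step (v w : W) : Prop :=
  (exists2 t, reflection t & w = v * t) /\ (len v < len w)%N.

Definition bruhat : W -> W -> Prop :=
  Relation_Operators.clos_refl_trans W bruhat_step.

Variable J : set I.

Definition parabolic : set W :=
  smallest (fun H : set W => group_closed [in H]) (s @` J).

Definition min_reps : set W :=
  [set w | forall u, parabolic u -> (len w <= len (w * u))%N].

Definition max_reps : set W :=
  [set w | forall u, parabolic u -> (len (w * u) <= len w)%N].

Definition IJ : set (W * W * W) :=
  [set t | let: (x, u, w) := t in
    [/\ max_reps x, parabolic u, min_reps w & bruhat x (w * u)]].

(* [None] is the added least element, [Some t] is [Q_t]. The elements
   [Q_{x,u,w}] with [x = wu] are atoms, hence have rank 1, not 0: counted from
   [None], the rank of [Q_{x,u,w}] is one more than [len (wu) - len x].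
   When W is infinite this poset is infinite without greatest element, so only
   its principal lower ideals can be graded in the sense of [graded]. *)
Definition QJ : Type := option IJ.

Definition QJ_le_triple (t t' : W * W * W) : Prop :=
  let: (x, u, w) := t in
  let: (x', u', w') := t' in
  exists u1 u2,
    [/\ parabolic u1, parabolic u2, u1 * u2 = u & len u = (len u1 + len u2)%N]
    /\ [/\ bruhat (x' * u'^-1) (x * u2^-1), bruhat (x * u2^-1) (w * u1)
         & bruhat (w * u1) w'].

Definition QJ_le : rel QJ := fun q q' =>
  match q, q' with
  | None, _ => true
  | Some _, None => false
  | Some t, Some t' => `[< QJ_le_triple (val t) (val t') >]
  end.

End CoxeterSystems.

(* Main.v *)
(** A triple [(x, u, w)] is encoded by the pair [(v, w)] with [v = x u^-1]: then
    [w] is a minimal representative, [v <= w], the rank is [l w - l v], and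
    [(v, w) <= (v', w')] iff [v' <= v a] and [w a <= w'] for some [a] in [W_J]. The
    length-additivity of [a] may be dropped here, because the Demazure product of
    [v] and [a] is [v a'] for a length-additive [a' <= a]. Antisymmetry and strict
    monotonicity of the rank follow from length counts, and gradedness reduces to
    finding an element strictly between two comparable pairs of rank gap at least
    two (see [pair_between]).

    The exchange property comes from the presentation: the parity of the number of
    occurrences of a reflection in a word is invariant under the Coxeter relations. *)

Require Import Defs.
From mathcomp Require Import all_boot.
From mathcomp Require Import boolp classical_sets functions cardinality.
From mathcomp Require Import zify.
From Stdlib Require Import Relation_Operators.

Set Implicit Arguments.
Unset Strict Implicit.
Unset Printing Implicit Defensive.

Local Open Scope classical_set_scope.
Local Open Scope group_scope.

Section Coxeter.
Variables (I : Type) (W : groupType) (s : I -> W).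

Lemma word_prod_nil : word_prod s [::] = 1.
Proof. exact: big_nil. Qed.

Lemma word_prod_cons i r : word_prod s (i :: r) = s i * word_prod s r.
Proof. exact: big_cons. Qed.

Lemma word_prod_cat r1 r2 :
  word_prod s (r1 ++ r2) = word_prod s r1 * word_prod s r2.
Proof. exact: big_cat. Qed.

Lemma word_prod1 i : word_prod s [:: i] = s i.
Proof. by rewrite word_prod_cons word_prod_nil mulg1. Qed.

Lemma word_prod_rcons r i : word_prod s (rcons r i) = word_prod s r * s i.
Proof. by rewrite -cats1 word_prod_cat word_prod1. Qed.

(* Parity of the number of positions [k] of the word [r = i_1 ... i_n] such that
   deleting the letter [i_k] amounts to right multiplication by [t]. *)
Fixpoint nrefl (r : seq I) (t : W) : bool :=
  if r is i :: r' then (s i ^ word_prod s r' == t) (+) nrefl r' t else false.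

(** Deleting a letter of [r1] happens to the left of [r2], so the corresponding reflection is
    conjugated by the product of [r2]; this makes [nrefl] a cocycle. *)
Lemma nrefl_cat r1 r2 t :
  nrefl (r1 ++ r2) t = nrefl r1 (t ^ (word_prod s r2)^-1) (+) nrefl r2 t.
Proof.
elim: r1 => //= i r1 ->; rewrite word_prod_cat conjgM addbA; congr (_ (+) _ (+) _).
by rewrite -(inj_eq (@conjg_inj _ (word_prod s r2)^-1)) conjgK.
Qed.

Hypothesis hW : coxeter_system s.

(** * The exchange property *)

Lemma s_invol i : s i * s i = 1.
Proof.
have [m [_ m1 _ /(_ [:: i; i] [::])[_]]] := hW.
rewrite word_prod_cons word_prod1 word_prod_nil; apply.
by have := cox_rel m i i; rewrite ((m1 i i).2 erefl).
Qed.

Lemma s_inv i : (s i)^-1 = s i.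
Proof. by apply: mulg1_eq; exact: s_invol. Qed.

Lemma mul_sK i x : x * s i * s i = x.
Proof. by rewrite -mulgA s_invol mulg1. Qed.

Lemma word_prod_surj w : exists r, word_prod s r = w.
Proof. by have [m []] := hW. Qed.

Lemma nrefl_delete r t : nrefl r t -> exists r1 i r2,
  r = r1 ++ i :: r2 /\ word_prod s r * t = word_prod s (r1 ++ r2).
Proof.
elim: r => //= i r IH; have [<- _|_ /IH] := eqVneq (s i ^ word_prod s r) t.
  exists [::], i, r; split=> //=.
  by rewrite word_prod_cons conjgE -mulgA mulVKg mulgA s_invol mul1g.
move=> [r1 [j [r2 [-> E]]]]; exists (i :: r1), j, r2; split=> //.
by rewrite !word_prod_cons -mulgA E.
Qed.

Lemma word_prod_nseq i j n :
  word_prod s (flatten (nseq n [:: i; j])) = (s i * s j) ^+ n.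
Proof.
elim: n => [|n IH]; first by rewrite word_prod_nil expg0.
by rewrite /= !word_prod_cons IH expgS mulgA.
Qed.

(** Conjugation by [s j] inverts [s i * s j]. *)
Lemma dihedral_conj i j n :
  (s i * s j) ^+ n * s j * (s i * s j) ^+ n = s j.
Proof.
elim: n => [|n IH]; first by rewrite expg0 mulg1 mul1g.
rewrite {1}expgSr expgS -!mulgA (mulgA (s j) (s j)) s_invol mul1g.
by rewrite (mulgA (s i) (s i)) s_invol mul1g mulgA IH.
Qed.

(** The letters of the alternating word, read from the right, give the reflections
    [s j * (s i * s j) ^+ l] in the order of [l]. *)
Lemma nrefl_dihedral i j n t :
  nrefl (flatten (nseq n [:: i; j])) t =
  \big[addb/false]_(0 <= l < n.*2) (s j * (s i * s j) ^+ l == t).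
Proof.
elim: n => [|n IH]; first by rewrite big_geq.
rewrite doubleS !big_nat_recr //= -IH word_prod_cons word_prod_nseq.
have conjE x y : (s i * s j) ^+ n * y = x * (s i * s j) ^+ n -> x ^ (s i * s j) ^+ n = y.
  by move=> E; rewrite conjgE -E mulKg.
have dihE k : (s i * s j) ^+ n * (s j * (s i * s j) ^+ (k + n)) = s j * (s i * s j) ^+ k.
  by rewrite addnC expgnDr !mulgA dihedral_conj.
rewrite conjgM (conjE _ (s j * (s i * s j) ^+ n.*2.+1)).
  rewrite (conjE _ (s j * (s i * s j) ^+ n.*2)).
    by rewrite [RHS]addbC; congr (_ (+) _); exact: addbC.
  by rewrite -addnn dihE.
by rewrite -addnn -addSn dihE conjgE s_inv expgS !mulgA.
Qed.

(** The list of [2n] reflections of the word now has period [n], so its two halves cancel modulo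
    2. *)
Lemma nrefl_rel i j n t : (s i * s j) ^+ n = 1 ->
  nrefl (flatten (nseq n [:: i; j])) t = false.
Proof.
move=> E; rewrite nrefl_dihedral -addnn (@big_cat_nat _ _ _ n) ?leq_addr //=.
rewrite -{2}[n]add0n big_addn addnK.
under [X in _ (+) X]eq_bigr do rewrite expgnDr E mulg1.
by rewrite addbb.
Qed.

(** Induction on a derivation of the congruence. The concatenation case also needs that congruent
    right factors have equal products, since this product conjugates [t] in [nrefl_cat]. *)
Lemma nrefl_word_prod r1 r2 : word_prod s r1 = word_prod s r2 -> nrefl r1 =1 nrefl r2.
Proof.
have [m [_ _ _ mP]] := hW; move=> /mP.
elim=> {r1 r2} [r|r1 r2 _ IH|r1 r2 r3 _ IH1 _ IH2|r1 r2 r1' r2' _ IH1 C2 IH2|i j] t //.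
- by rewrite IH1.
- by rewrite !nrefl_cat ((mP r2 r2').2 C2) IH1 IH2.
- apply: nrefl_rel; rewrite -word_prod_nseq -word_prod_nil; apply/mP.
  exact: cox_rel.
Qed.

Lemma word_prod_rev r : word_prod s (rev r) = (word_prod s r)^-1.
Proof.
elim: r => [|i r IH]; first by rewrite word_prod_nil invg1.
by rewrite rev_cons word_prod_rcons IH word_prod_cons invgM s_inv.
Qed.

(* With [t = g s_i g^-1], the word [g s_i g^-1] of [t] contains [t] at its middle
   letter, and the other positions at which it occurs are paired off because the
   word [g g^-1] of [1] contains [t] an even number of times. *)
Lemma nrefl_self r t : reflection s t -> word_prod s r = t -> nrefl r t.
Proof.
move=> [i [g tE]] rE; have [q qE] := word_prod_surj g.
have -> : nrefl r t = nrefl (q ++ i :: rev q) t.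
  apply: nrefl_word_prod.
  by rewrite rE word_prod_cat word_prod_cons word_prod_rev qE tE mulgA.
have : nrefl (q ++ rev q) t = false.
  have -> : nrefl (q ++ rev q) t = nrefl [::] t; last by [].
  by apply: nrefl_word_prod; rewrite word_prod_cat word_prod_rev mulgV word_prod_nil.
have tg : t ^ g = s i by rewrite conjgE tE !mulgA mulVg mul1g mulgVK.
have sg : s i ^ g^-1 = t by rewrite conjgE invgK tE mulgA.
rewrite !nrefl_cat /= word_prod_cons word_prod_rev qE invgM !invgK s_inv conjgM.
by rewrite tg sg eqxx conjgE s_inv s_invol mulg1 => /negbT; case: nrefl; case: nrefl.
Qed.

(** * Length and the strong exchange property *)

Lemma is_lengthP w : is_length s w (len s w).
Proof.
(* Every element has a word, so the default 0 in [len] is never taken for lack of a length. *)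
apply: (@xgetPex _ 0%N [set n | is_length s w n]).
have ex : exists n, `[< exists2 r, word_prod s r = w & size r = n >].
  by have [r rE] := word_prod_surj w; exists (size r); apply/asboolP; exists r.
exists (ex_minn ex); case: ex_minnP => n /asboolP[r rE rn] nmin; split; first by exists r.
by move=> r' r'E; apply: nmin; apply/asboolP; exists r'.
Qed.

Lemma len_word r : (len s (word_prod s r) <= size r)%N.
Proof. by have [_] := is_lengthP (word_prod s r); apply. Qed.

Lemma reduced_word w : exists r, word_prod s r = w /\ size r = len s w.
Proof. by have [[r ? ?] _] := is_lengthP w; exists r. Qed.

Lemma len1 : len s 1 = 0.
Proof. by apply/eqP; rewrite -leqn0 -word_prod_nil len_word. Qed.

Lemma len_eq0 w : len s w = 0 -> w = 1.
Proof.
have [r [<- <-]] := reduced_word w => /size0nil ->; exact: word_prod_nil.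
Qed.

Lemma len_mul x y : (len s (x * y) <= len s x + len s y)%N.
Proof.
have [[r [<- <-]] [r' [<- <-]]] := (reduced_word x, reduced_word y).
by rewrite -word_prod_cat -size_cat len_word.
Qed.

Lemma len_inv w : len s w^-1 = len s w.
Proof.
have le x : (len s x^-1 <= len s x)%N.
  by have [r [<- <-]] := reduced_word x; rewrite -word_prod_rev -(size_rev r) len_word.
by apply/eqP; rewrite eqn_leq le -{1}[w]invgK le.
Qed.

Lemma reflection_s i : reflection s (s i).
Proof. by exists i, 1; rewrite invg1 mulg1 mul1g. Qed.

Lemma reflection_conj t g : reflection s t -> reflection s (t ^ g).
Proof.
by move=> [i [h ->]]; exists i, (g^-1 * h); rewrite conjgE invgM invgK !mulgA.
Qed.

Lemma reflection_invol t : reflection s t -> t * t = 1.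
Proof.
by move=> [i [h ->]]; rewrite !mulgA mulgVK -(mulgA h) s_invol mulg1 mulgV.
Qed.

Lemma delete_size r1 i (r2 : seq I) : size (r1 ++ i :: r2) = (size (r1 ++ r2)).+1.
Proof. by rewrite !size_cat /= addnS. Qed.

Lemma nrefl_len r t : nrefl r t -> (len s (word_prod s r * t) < len s (word_prod s r))%N.
Proof.
have [q [qE <-]] := reduced_word (word_prod s r).
rewrite -qE -(nrefl_word_prod qE) => /nrefl_delete[r1 [i [r2 [-> ->]]]].
by rewrite delete_size ltnS len_word.
Qed.

(** By [nrefl_self], appending a word of [t] flips the parity at [t]; then [nrefl_len] applies to
    the longer word and multiplication by [t] leads back to [r]. *)
Lemma nreflN_len r t : reflection s t -> ~~ nrefl r t ->
  (len s (word_prod s r) < len s (word_prod s r * t))%N.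
Proof.
move=> ht; have [q qE] := word_prod_surj t => nr.
have : nrefl (r ++ q) t.
  rewrite nrefl_cat qE conjgE invgK mulgV mulg1 (nrefl_self ht qE).
  by rewrite (negbTE nr).
move=> /nrefl_len; rewrite word_prod_cat qE.
by rewrite -mulgA (reflection_invol ht) mulg1.
Qed.

Lemma len_refl_neq w t : reflection s t -> len s (w * t) <> len s w.
Proof.
move=> ht; have [r <-] := word_prod_surj w.
by have [/nrefl_len|/(nreflN_len ht)] := boolP (nrefl r t); lia.
Qed.

Lemma strong_exchange r t : reflection s t ->
  (len s (word_prod s r * t) < len s (word_prod s r))%N ->
  exists r1 i r2, r = r1 ++ i :: r2 /\ word_prod s r * t = word_prod s (r1 ++ r2).
Proof.
move=> ht lt; apply: nrefl_delete; apply: contraTT lt => /(nreflN_len ht).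
by rewrite -leqNgt => /ltnW.
Qed.

Lemma len_s w i : len s (w * s i) = (len s w).+1 \/ len s w = (len s (w * s i)).+1.
Proof.
have l1 : (len s (s i) <= 1)%N by rewrite -word_prod1 len_word.
have := @len_refl_neq w _ (reflection_s i).
have := len_mul w (s i); have := len_mul (w * s i) (s i); rewrite mul_sK.
lia.
Qed.

Lemma len_ind (P : W -> Prop) : P 1 ->
  (forall w i, len s (w * s i) = (len s w).+1 -> P w -> P (w * s i)) -> forall w, P w.
Proof.
move=> P1 PS w; have [r [<-]] := reduced_word w.
elim/last_ind: r => [|r i IH]; first by rewrite word_prod_nil.
rewrite size_rcons word_prod_rcons => E.
have [lr|lr] := len_s (word_prod s r) i; last by have := len_word r; lia.
by apply: PS => //; apply: IH; lia.
Qed.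


Local Notation l := (len s).
Local Notation "x <=B y" := (bruhat s x y) (at level 70, no associativity).

(** * Bruhat order *)

Lemma bruhat_refl x : x <=B x.
Proof. exact: rt_refl. Qed.

Lemma bruhat_trans y x z : x <=B y -> y <=B z -> x <=B z.
Proof. exact: rt_trans. Qed.

Lemma bruhat_refl_le x t : reflection s t -> (l x < l (x * t))%N -> x <=B x * t.
Proof. by move=> ht lt; apply: rt_step; split=> //; exists t. Qed.

Lemma bruhat_s x i : (l x < l (x * s i))%N -> x <=B x * s i.
Proof. exact/bruhat_refl_le/reflection_s. Qed.

Lemma bruhat_refl_ge x t : reflection s t -> (l (x * t) < l x)%N -> x * t <=B x.
Proof.
move=> ht lt; have xE : x * t * t = x by rewrite -mulgA (reflection_invol ht) mulg1.
by rewrite -{2}xE; apply: bruhat_refl_le; rewrite ?xE.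
Qed.

Lemma bruhat_s_le x i : (l (x * s i) < l x)%N -> x * s i <=B x.
Proof. exact/bruhat_refl_ge/reflection_s. Qed.

Lemma bruhat_len x y : x <=B y -> x = y \/ (l x < l y)%N.
Proof.
elim=> {x y} [x y [_ ?]|x|x y z _ [->|xy] _ [<-|yz]]; auto.
by right; apply: ltn_trans yz.
Qed.

Lemma bruhat_len_le x y : x <=B y -> (l x <= l y)%N.
Proof. by move=> /bruhat_len[->|/ltnW]. Qed.

Lemma bruhat_len_eq x y : x <=B y -> (l y <= l x)%N -> x = y.
Proof. by move=> /bruhat_len[->//|]; rewrite ltnNge => /negP. Qed.

Lemma bruhat_anti x y : x <=B y -> y <=B x -> x = y.
Proof. by move=> xy /bruhat_len_le; exact: bruhat_len_eq. Qed.

Lemma bruhat_inv x y : x <=B y -> x^-1 <=B y^-1.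
Proof.
elim=> {x y} [x y [[t ht yE] lt]|x|x y z _ xy _ yz]; last exact: bruhat_trans yz.
  have -> : y^-1 = x^-1 * t ^ x^-1.
    rewrite conjgE invgK !mulgA mulVg mul1g yE invgM; congr (_ * _).
    exact: mulg1_eq (reflection_invol ht).
  apply: bruhat_refl_le; first exact: reflection_conj.
  have -> : x^-1 * t ^ x^-1 = y^-1.
    rewrite conjgE invgK !mulgA mulVg mul1g yE invgM; congr (_ * _).
    exact/esym/mulg1_eq/reflection_invol.
  by rewrite !len_inv.
exact: bruhat_refl.
Qed.

Lemma bruhat_1 x : 1 <=B x.
Proof.
elim/len_ind: x => [|x i lx]; first exact: bruhat_refl.
by move/bruhat_trans; apply; apply: bruhat_s; rewrite lx.
Qed.

Lemma conj_s_mul x t i : x * s i * t ^ s i = x * t * s i.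
Proof. by rewrite conjgE s_inv !mulgA mul_sK. Qed.

(* Whether [l (w * t) < l w] is decided by the parity of the occurrences of [t]
   in a word of [w], which is additive along a factorization [w = x * y]. *)
Lemma exchange_mul x y t : reflection s t -> (l (x * y * t) < l (x * y))%N ->
  (l (y * t) < l y)%N \/ (l (x * t ^ y^-1) < l x)%N.
Proof.
have [[r <-] [q <-]] := (word_prod_surj x, word_prod_surj y) => ht.
rewrite -word_prod_cat => lt.
have : nrefl (r ++ q) t.
  by apply: contraTT lt => /(nreflN_len ht); rewrite -leqNgt => /ltnW.
rewrite nrefl_cat; case: (boolP (nrefl q t)) => [/nrefl_len|_]; first by left.
by rewrite addbF => /nrefl_len; right.
Qed.

Lemma exchange_s i t : reflection s t -> (l (s i * t) < l (s i))%N -> t = s i.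
Proof.
move=> ht; have := len_word [:: i]; rewrite word_prod1 /= => l1 lt.
have /len_eq0 st : l (s i * t) = 0%N by lia.
by rewrite -[t](mulKg (s i)) st mulg1 s_inv.
Qed.

(** The elements [x * s i] and [x * t * s i] differ by the reflection [t ^ s i], hence are
    comparable. If the order is the wrong one while [x * s i] is longer than [x], exchange forces
    [t = s i]. *)
Lemma bruhat_step_lift x t i : reflection s t -> (l x < l (x * t))%N ->
  x * s i <=B x * t \/ x * s i <=B x * t * s i.
Proof.
move=> ht lt; have ht' := reflection_conj (s i) ht.
have [xs|xs] := len_s x i; last first.
  left; apply: (@bruhat_trans x); last exact: bruhat_refl_le.
  by apply: bruhat_s_le; rewrite xs.
have [lt'|] := ltnP (l (x * s i)) (l (x * t * s i)).
  by right; rewrite -conj_s_mul; apply: bruhat_refl_le => //; rewrite conj_s_mul.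
rewrite leq_eqVlt => /orP[/eqP E|gt].
  by have := len_refl_neq (w := x * s i) ht'; rewrite conj_s_mul E.
rewrite -conj_s_mul in gt.
have [/(exchange_s ht') tE|lt'] := exchange_mul ht' gt.
  left; have -> : t = s i; last exact: bruhat_refl.
  by rewrite -[t](conjgK (s i)) tE conjgE invgK mulgV mulg1.
by move: lt'; rewrite conjgK ltnNge ltnW.
Qed.

Lemma bruhat_step_lower x t i : reflection s t -> (l x < l (x * t))%N ->
  x <=B x * t * s i \/ x * s i <=B x * t * s i.
Proof.
move=> ht lt; have ht' := reflection_conj (s i) ht.
have [ys|ys] := len_s (x * t) i.
  left; apply: (@bruhat_trans (x * t)); first exact: bruhat_refl_le.
  by apply: bruhat_s; rewrite ys.
have [lt'|] := ltnP (l (x * s i)) (l (x * t * s i)).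
  by right; rewrite -conj_s_mul; apply: bruhat_refl_le => //; rewrite conj_s_mul.
rewrite leq_eqVlt => /orP[/eqP E|gt].
  by have := len_refl_neq (w := x * s i) ht'; rewrite conj_s_mul E.
(* Exchange for the factorization of [x * t] as [(x * t * s i) * s i]: either [t = s i], or
   [x * s i] is shorter than [x * t * s i], against [gt]. *)
left; have yt : (l (x * t * s i * s i * t) < l (x * t * s i * s i))%N.
  by rewrite mul_sK -mulgA (reflection_invol ht) mulg1.
have [/(exchange_s ht) tE|] := exchange_mul ht yt.
  rewrite tE mul_sK; exact: bruhat_refl.
by rewrite s_inv conj_s_mul -(mulgA x) (reflection_invol ht) mulg1 ltnNge ltnW.
Qed.

Lemma bruhat_lift x y i : x <=B y -> x * s i <=B y \/ x * s i <=B y * s i.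
Proof.
elim=> {x y} [x _ [[t ht ->] lt]|x|x y z _ IHxy yz IHyz].
- exact: bruhat_step_lift.
- by right; exact: bruhat_refl.
- case: IHxy => [xy|xy]; first by left; exact: bruhat_trans yz.
  by case: IHyz => ?; [left|right]; apply: bruhat_trans xy _.
Qed.

Lemma bruhat_lower x y i : x <=B y -> x <=B y * s i \/ x * s i <=B y * s i.
Proof.
elim=> {x y} [x _ [[t ht ->] lt]|x|x y z xy IHxy _ IHyz].
- exact: bruhat_step_lower.
- by right; exact: bruhat_refl.
- case: IHyz => [yz|yz]; first by left; exact: bruhat_trans yz.
  by case: IHxy => ?; [left|right]; exact: bruhat_trans yz.
Qed.

Lemma bruhat_lift_up x y i : x <=B y -> (l y < l (y * s i))%N -> x * s i <=B y * s i.
Proof.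
move=> xy /bruhat_s yys; have [xsy|//] := bruhat_lift i xy; exact: bruhat_trans yys.
Qed.

(** * Subwords, coatoms and atoms *)

Lemma mask_mask (T : Type) (r : seq T) m m' :
  exists2 m'', size m'' = size r & mask m' (mask m r) = mask m'' r.
Proof.
elim: r m m' => [|a r IH] m m'; first by exists [::] => //; rewrite !mask0.
have skip u v : exists2 m'', size m'' = (size r).+1 &
    mask v (mask u r) = mask m'' (a :: r).
  by have [m'' sm E] := IH u v; exists (false :: m''); rewrite //= sm.
case: m => [|[] m]; [by have := skip [::] m'| |exact: skip].
case: m' => [|[] m']; [by have := skip m [::]| |exact: skip].
by have [m'' sm E] := IH m m'; exists (true :: m''); rewrite /= ?sm ?E.
Qed.

(** Subword property, for words that may be non-reduced: each Bruhat step down deletes one letter by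
    strong exchange. *)
Lemma bruhat_delete r x : x <=B word_prod s r ->
  exists2 m, size m = size r & x = word_prod s (mask m r).
Proof.
move eqy: (word_prod s r) => y xy; elim: xy r eqy => {x y}.
- move=> x y [[t ht yE] lt] r ryE.
  have xE : x = y * t by rewrite yE -mulgA (reflection_invol ht) mulg1.
  move: lt; rewrite xE -ryE => /strong_exchange[//|r1 [i [r2 [-> ->]]]].
  exists (nseq (size r1) true ++ false :: nseq (size r2) true).
    by rewrite !size_cat /= !size_nseq.
  by rewrite mask_cat ?size_nseq //= !mask_true.
- by move=> x r <-; exists (nseq (size r) true); rewrite ?size_nseq ?mask_true.
- move=> x y z _ IHxy _ IHyz r /IHyz[m _ yE].
  have [m' _ ->] := IHxy _ (esym yE); have [m'' sm ->] := mask_mask r m m'.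
  by exists m''.
Qed.

(** Induction on the upper element [y * s i]. If [x <=B y], then [y] is the coatom. Otherwise
    [x * s i] is below both [x] and [y], and a coatom [z] of the interval from [x * s i] to [y]
    lifts to [z * s i]. *)
Lemma bruhat_coatom x y : x <=B y -> (l x < l y)%N ->
  exists z, [/\ x <=B z, z <=B y & l y = (l z).+1].
Proof.
elim/len_ind: y x => [|y i ly IH] x xy lxy; first by rewrite len1 in lxy.
have yys : y <=B y * s i by apply: bruhat_s; rewrite ly.
have [xy'|xNy] := pselect (x <=B y); first by exists y; split.
have [xs|xs] : x <=B y \/ x * s i <=B y by rewrite -[y](mul_sK i); exact: bruhat_lower.
  by [].
have [lx|lx] := len_s x i.
  by case: xNy; apply: bruhat_trans xs; apply: bruhat_s; rewrite lx.
have [|z [xz zy lz]] := IH _ xs; first by lia.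
have xzs : x <=B z * s i.
  have := bruhat_lift i xz; rewrite mul_sK => -[xz'|//].
  by case: xNy; exact: bruhat_trans zy.
have [lzs|lzs] := len_s z i; last first.
  case: xNy; apply: bruhat_trans xzs _; apply: bruhat_trans zy.
  by apply: bruhat_s_le; rewrite lzs.
exists (z * s i); split=> //; last by lia.
by apply: bruhat_lift_up; rewrite ?ly.
Qed.

(** Descend through coatoms until the next one is [x] itself. *)
Lemma bruhat_atom x y : x <=B y -> (l x < l y)%N ->
  exists z, [/\ x <=B z, z <=B y & l z = (l x).+1].
Proof.
move: {-1}(l y) (erefl (l y)) => n; elim: n y => [|n IH] y ly xy lxy; first by lia.
have [z [xz zy lz]] := bruhat_coatom xy ltac:(by rewrite ly).
have [xzE|lt] := bruhat_len xz.
  by exists y; split=> //; [exact: bruhat_refl|rewrite lz xzE].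
have [z' [? ? ?]] := IH z ltac:(lia) xz ltac:(lia).
by exists z'; split=> //; exact: bruhat_trans zy.
Qed.

(** * Demazure products *)

(** Here [z] is the Demazure product of [x] and [b], with two length-additive factorizations, one
    keeping [x] and one keeping [b]. It is built along a reduced word of [b], multiplying by a
    letter only when this increases the length. *)
Lemma demazure_max x b : exists z c x1,
  [/\ z = x * c, z = x1 * b, c <=B b & x1 <=B x] /\
  [/\ l z = (l x + l c)%N, l z = (l x1 + l b)%N
    & forall p b', p <=B x -> b' <=B b -> p * b' <=B z].
Proof.
elim/len_ind: b => [|b i lb [z [c [x1 [[zc zb cb x1x] [lc l1 zmax]]]]]].
  exists x, 1, x; rewrite !mulg1 len1 addn0; split; split=> //; try exact: bruhat_refl.
  by move=> p b' px /bruhat_len_le; rewrite len1 leqn0 => /eqP/len_eq0->; rewrite mulg1.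
have bbs : b <=B b * s i by apply: bruhat_s; rewrite lb.
have low b' : b' <=B b * s i -> b' <=B b \/ b' * s i <=B b.
  by move=> /(bruhat_lower i); rewrite mul_sK.
have [lz|lz] := len_s z i.
  have zzs : z <=B z * s i by apply: bruhat_s; rewrite lz.
  exists (z * s i), (c * s i), x1; split; split=> //.
  - by rewrite zc mulgA.
  - by rewrite zb mulgA.
  - by apply: bruhat_lift_up => //; rewrite lb.
  - have := len_mul x (c * s i); rewrite mulgA -zc lz lc.
    by case: (len_s c i); lia.
  - by rewrite lz l1 lb addnS.
  - move=> p b' px /low[b'b|b'b].
      by apply: bruhat_trans zzs; exact: zmax.
    rewrite -[b'](mul_sK i) mulgA; apply: bruhat_lift_up; first exact: zmax.
    by rewrite lz.
have zsz : z * s i <=B z by apply: bruhat_s_le; rewrite lz.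
(* The product stays [z], but its right factor must grow to [b * s i]. As [s i] is a descent of
   [x1 * b] and not of [b], exchange moves it into [x1], which becomes the shorter [x1 * t]. *)
have [||lt] := @exchange_mul x1 b (s i) (reflection_s i).
- by rewrite -zb lz.
- by rewrite lb ltnNge leqnSn.
set t := s i ^ b^-1 in lt.
have ht : reflection s t by apply: reflection_conj; exact: reflection_s.
have zt : z = x1 * t * (b * s i).
  by rewrite /t conjgE invgK !mulgA mulgVK mul_sK.
exists z, c, (x1 * t); split; split=> //.
- exact: bruhat_trans bbs.
- by apply: bruhat_trans x1x; exact: bruhat_refl_ge.
- by apply/eqP; rewrite eqn_leq {1}zt len_mul //= l1 lb; lia.
- move=> p b' px /low[b'b|b'b]; first exact: zmax.
  have := bruhat_lift i (zmax _ _ px b'b); rewrite mulgA mul_sK => -[//|h].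
  exact: bruhat_trans zsz.
Qed.

(** The dual construction: a letter of [b] is applied only when it decreases the length. *)
Lemma demazure_min x b : exists z e,
  [/\ z = x * e, e <=B b, l x = (l z + l e)%N & forall b', b' <=B b -> z <=B x * b'].
Proof.
elim/len_ind: b => [|b i lb [z [e [zE eb lx zmin]]]].
  exists x, 1; rewrite mulg1 len1 addn0; split=> //; first exact: bruhat_refl.
  move=> b' /bruhat_len_le; rewrite len1 leqn0 => /eqP/len_eq0->.
  by rewrite mulg1; exact: bruhat_refl.
have bbs : b <=B b * s i by apply: bruhat_s; rewrite lb.
have low b' : b' <=B b * s i -> z <=B x * b' \/ z <=B x * b' * s i.
  move=> /(bruhat_lower i); rewrite mul_sK => -[/zmin|/zmin]; first by left.
  by rewrite mulgA; right.
have [lz|lz] := len_s z i.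
  have zzs : z <=B z * s i by apply: bruhat_s; rewrite lz.
  exists z, e; split=> //; first exact: bruhat_trans bbs.
  move=> b' /low[//|/(bruhat_lower i)]; rewrite mul_sK => -[//|].
  exact: bruhat_trans.
have zsz : z * s i <=B z by apply: bruhat_s_le; rewrite lz.
exists (z * s i), (e * s i); split.
- by rewrite zE mulgA.
- by apply: bruhat_lift_up; rewrite ?lb.
- have xE : x = z * s i * (e * s i)^-1 by rewrite invgM s_inv mulgA mul_sK zE mulgK.
  have := len_mul (z * s i) (e * s i)^-1; rewrite -xE len_inv.
  by case: (len_s e i); lia.
- move=> b' /low[h|/(bruhat_lower i)]; first exact: bruhat_trans h.
  by rewrite mul_sK => -[h|//]; exact: bruhat_trans h.
Qed.

(** The letters of [b] are stripped from the right by [bruhat_lower]; those that have to be stripped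
    from [p] as well make up [c]. *)
Lemma bruhat_mul_lower p q b : p <=B q * b -> exists c, c <=B b /\ p * c^-1 <=B q.
Proof.
elim/len_ind: b p => [|b i lb IH] p.
  by rewrite mulg1 => pq; exists 1; rewrite invg1 mulg1; split=> //; exact: bruhat_refl.
rewrite mulgA => /(bruhat_lower i); rewrite mul_sK => -[/IH|/IH] [c [cb pc]].
  exists c; split=> //; apply: bruhat_trans cb _.
  by apply: bruhat_s; rewrite lb.
exists (c * s i); split; first by apply: bruhat_lift_up; rewrite ?lb.
by rewrite invgM s_inv mulgA.
Qed.

Lemma bruhat_finite y : finite_set [set x | x <=B y].
Proof.
have [r <-] := word_prod_surj y.
pose f (m : (size r).-tuple bool) := word_prod s (mask m r).
apply: (@sub_finite_set _ _ (f @` setT)); last exact: finite_image.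
move=> x /bruhat_delete[m /eqP sm ->]; by exists (Tuple sm).
Qed.

Variable J : set I.
Local Notation WJ := (parabolic s J).

(** * Parabolic subgroups *)

Lemma parabolicP u : WJ u <->
  exists2 r, all (fun i => `[< J i >]) r & word_prod s r = u.
Proof.
split.
  apply: (@smallest_sub _ _ _ [set u | exists2 r, all (fun i => `[< J i >]) r &
      word_prod s r = u]) u; last first.
    move=> _ [j Jj <-]; exists [:: j]; last exact: word_prod1.
    by rewrite /= andbT; apply/asboolP.
  split=> [|x y]; first by rewrite inE; exists [::] => //; exact: word_prod_nil.
  rewrite !inE => -[r rJ <-] [q qJ <-]; exists (r ++ rev q).
    by rewrite all_cat all_rev rJ.
  by rewrite word_prod_cat word_prod_rev.
case=> r rJ <- H [HG sH].
have HM x y : H x -> H y -> H (x * y).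
  move=> Hx Hy; suff : x * y \in [in H] by rewrite inE.
  by apply: (group_closedM HG); rewrite inE.
elim: r rJ => [|i r IH] /=; first by rewrite word_prod_nil; case: HG; rewrite inE.
move=> /andP[/asboolP Ji rJ]; rewrite word_prod_cons; apply: HM; last exact: IH.
by apply: sH; exists i.
Qed.

Lemma parabolic1 : WJ 1.
Proof. by apply/parabolicP; exists [::] => //; exact: word_prod_nil. Qed.

Lemma parabolicM x y : WJ x -> WJ y -> WJ (x * y).
Proof.
move=> /parabolicP[r rJ <-] /parabolicP[q qJ <-]; apply/parabolicP.
by exists (r ++ q); rewrite ?all_cat ?rJ // word_prod_cat.
Qed.

Lemma parabolicV x : WJ x -> WJ x^-1.
Proof.
move=> /parabolicP[r rJ <-]; apply/parabolicP.
by exists (rev r); rewrite ?all_rev // word_prod_rev.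
Qed.

Lemma parabolic_le x y : x <=B y -> WJ y -> WJ x.
Proof.
move=> xy /parabolicP[r rJ rE]; move: xy; rewrite -rE => /bruhat_delete[m sm ->].
apply/parabolicP; exists (mask m r) => //.
move: rJ {sm rE}; elim: r m => [|i r IH] [|[] m] //= /andP[Ji /(IH m)] //.
by rewrite Ji.
Qed.

(** The Demazure product of [w] and [u] is [x1 * u] with [x1 <=B w] in the coset of [w]. Minimality
    of [w] gives [x1 = w], so [w * u] is this product and inherits its additivity and maximality. *)
Lemma min_reps_mul w u : min_reps s J w -> WJ u ->
  l (w * u) = (l w + l u)%N /\
  forall p b, p <=B w -> b <=B u -> p * b <=B w * u.
Proof.
move=> wmin uJ; have [z [c [x1 [[zc zx cu x1w] [_ lz zmax]]]]] := demazure_max w u.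
have x1E : x1 = w * (c * u^-1) by rewrite mulgA -zc zx mulgK.
have cJ := parabolic_le cu uJ.
suff E : x1 = w by rewrite E in zx lz; rewrite -zx.
apply: bruhat_len_eq x1w _; rewrite x1E; apply: wmin.
by apply: parabolicM => //; exact: parabolicV.
Qed.

Lemma min_reps_inj w p : min_reps s J w -> min_reps s J (w * p) -> WJ p -> p = 1.
Proof.
move=> wmin wpmin pJ; have [E _] := min_reps_mul wmin pJ.
have := wpmin _ (parabolicV pJ); rewrite mulgK E => le; apply: len_eq0; lia.
Qed.

Lemma min_reps_decomp y : exists w b, [/\ min_reps s J w, WJ b & y = w * b].
Proof.
have ex : exists n, `[< exists w b, [/\ WJ b, y = w * b & l w = n] >].
  exists (l y); apply/asboolP; exists y, 1; rewrite mulg1; split=> //.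
  exact: parabolic1.
case: (ex_minnP ex) => n /asboolP[w [b [bJ yE ln]]] nmin; exists w, b; split=> //.
move=> u uJ; rewrite ln; apply: nmin; apply/asboolP; exists (w * u), (u^-1 * b).
split=> //; first by apply: parabolicM => //; exact: parabolicV.
by rewrite -mulgA mulVKg.
Qed.

(** Maximality makes the Demazure product of [x] and [u^-1] equal to [x]; its factorization keeping
    [u^-1] has left factor [x * u]. *)
Lemma max_reps_mul x u : max_reps s J x -> WJ u -> l x = (l (x * u) + l u)%N.
Proof.
move=> xmax uJ; have [z [c [x1 [[zc zx cu _] [lc lz _]]]]] := demazure_max x u^-1.
have cJ := parabolic_le cu (parabolicV uJ).
have /len_eq0 c1 : l c = 0%N by have := xmax _ cJ; rewrite -zc lc; lia.
rewrite c1 mulg1 in zc; have -> : x * u = x1 by rewrite -zc zx mulgVK.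
by rewrite -(len_inv u) -lz zc.
Qed.

Lemma max_reps_inj x p : max_reps s J x -> max_reps s J (x * p) -> WJ p -> p = 1.
Proof.
move=> xmax xpmax pJ; have E := max_reps_mul xmax pJ.
have := xpmax _ (parabolicV pJ); rewrite mulgK E => le; apply: len_eq0; lia.
Qed.

Lemma max_reps_exists v : finite_set WJ -> exists2 u, WJ u & max_reps s J (v * u).
Proof.
move=> /finite_seqP[S SE].
have ex : exists n, `[< exists2 u, WJ u & l (v * u) = n >].
  by exists (l (v * 1)); apply/asboolP; exists 1 => //; exact: parabolic1.
have bd n : `[< exists2 u, WJ u & l (v * u) = n >] -> (n <= \max_(u <- S) l (v * u)%g)%N.
  move=> /asboolP[u + <-]; rewrite SE => /= uS.
  exact: (@leq_bigmax_seq _ _ _ (fun u => l (v * u))).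
case: (ex_maxnP ex bd) => n /asboolP[u uJ <-] nmax; exists u => // u' u'J.
apply: nmax; apply/asboolP; exists (u * u'); rewrite ?mulgA //.
exact: parabolicM.
Qed.

(** * The order on pairs *)

Definition pairs : set (W * W) := [set p | min_reps s J p.2 /\ p.1 <=B p.2].

Definition pair_le (p q : W * W) :=
  exists a, [/\ WJ a, q.1 <=B p.1 * a & p.2 * a <=B q.2].

Lemma pair_le_refl p : pair_le p p.
Proof. by exists 1; rewrite !mulg1; split; [exact: parabolic1|exact: bruhat_refl..]. Qed.

Lemma pair_le_trans q p r : pairs q -> pair_le p q -> pair_le q r -> pair_le p r.
Proof.
move=> [qmin _] [a [aJ qpa paq]] [b [bJ rqb qbr]].
(* The witness is [a * c]: the Demazure product [p.1 * a * c] dominates [q.1 * b], and [c <=B b]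
   keeps [p.2 * a * c] below [q.2 * b]. *)
have [z [c [x1 [[zc _ cb _] [_ _ zmax]]]]] := demazure_max (p.1 * a) b.
exists (a * c); split.
- by apply: parabolicM => //; exact: parabolic_le cb bJ.
- rewrite mulgA -zc; apply: bruhat_trans rqb _; apply: zmax => //; exact: bruhat_refl.
- rewrite mulgA; apply: bruhat_trans qbr; exact: (min_reps_mul qmin bJ).2.
Qed.

(** Monotonicity of the rank, written additively to avoid truncated subtraction: a witness [a] adds
    exactly [l a] to the length of [p.2] and at most [l a] to that of [p.1]. *)
Lemma pair_le_len p q : pairs p -> pair_le p q ->
  (l p.2 + l q.1 <= l q.2 + l p.1)%N.
Proof.
move=> [pmin _] [a [aJ /bruhat_len_le l1 /bruhat_len_le]].
by rewrite (min_reps_mul pmin aJ).1; have := len_mul p.1 a; lia.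
Qed.

(** Equal ranks make both Bruhat inequalities equalities, so [w] and [w * a] are minimal
    representatives of one coset and [a = 1]. *)
Lemma pair_le_len_eq p q : pairs p -> pairs q -> pair_le p q ->
  (l q.2 + l p.1 <= l p.2 + l q.1)%N -> p = q.
Proof.
case: p q => [v w] [v' w'] [/= wmin vw] [/= wmin' _] [a [aJ /= v'va waw']] le.
have := bruhat_len_le v'va; have := bruhat_len_le waw'; have := len_mul v a.
rewrite (min_reps_mul wmin aJ).1 => l1 l2 l3.
have v'E : v' = v * a by apply: bruhat_len_eq v'va _; lia.
have w'E : w * a = w' by apply: bruhat_len_eq waw' _;
  rewrite (min_reps_mul wmin aJ).1; lia.
have a1 : a = 1 by apply: (min_reps_inj wmin _ aJ); rewrite w'E.
by rewrite v'E -w'E a1 !mulg1.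
Qed.

(** A witness [b] may be shrunk to the [c <=B b] for which [v * c] is the Demazure product of [v]
    and [b]. *)
Lemma pair_le_add v w v' w' : min_reps s J w -> pair_le (v, w) (v', w') ->
  exists a, [/\ WJ a, v' <=B v * a, w * a <=B w' & l (v * a) = (l v + l a)%N].
Proof.
move=> wmin [b [bJ /= v'vb wbw']].
have [z [c [x1 [[zc _ cb _] [lc _ zmax]]]]] := demazure_max v b.
exists c; split; [exact: parabolic_le cb bJ| | |by rewrite -zc].
  by rewrite -zc; apply: bruhat_trans v'vb _; apply: zmax; exact: bruhat_refl.
apply: bruhat_trans wbw'; apply: (min_reps_mul wmin bJ).2 => //; exact: bruhat_refl.
Qed.

(* Write [a] for a length-additive witness of [(v, w) <= (v', w')]. If [v' < v a],
   an atom of the Bruhat interval [[v', v a]] works. If [v' = v a], take a coatom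
   [y = w1 b] of [[w a, w']] and project: [(min_{b' <= b} v a b'^-1, w1)] lies in
   between. When it equals [(v, w)], the Demazure product [v * b] is either
   different from [v a], and then [(v * b, w')] works, or [a = b] and [w a = y] is
   a coatom, contradicting the rank hypothesis. *)
Lemma pair_between p q : pairs p -> pairs q -> pair_le p q ->
  (l p.2 + l q.1 + 2 <= l q.2 + l p.1)%N ->
  exists r, [/\ pairs r, pair_le p r, pair_le r q, r <> p & r <> q].
Proof.
case: p q => [v w] [v' w'] [/= wmin vw] [/= wmin' vw'] /(pair_le_add wmin).
move=> [a [aJ v'va waw' la]] gap.
have lwa := (min_reps_mul wmin aJ).1.
have vawa : v * a <=B w * a by apply: (min_reps_mul wmin aJ).2 => //; exact: bruhat_refl.
have vaw' := bruhat_trans vawa waw'.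
have lvl : (l v <= l w)%N := bruhat_len_le vw.
have [v'E|lt] := bruhat_len v'va; last first.
  have [z [v'z zva lz]] := bruhat_atom v'va lt.
  exists (z, w'); split.
  - by split=> //=; exact: bruhat_trans zva vaw'.
  - by exists a.
  - exists 1; rewrite !mulg1; split=> //=; [exact: parabolic1|exact: bruhat_refl].
  - by move=> [zE wE]; move: gap lz; rewrite zE wE; lia.
  - by move=> [zE]; move: lz; rewrite zE; lia.
subst v'; have [y [way yw' ly]] : exists y, [/\ w * a <=B y, y <=B w' & l w' = (l y).+1].
  by apply: bruhat_coatom => //; lia.
have [w1 [b [w1min bJ yE]]] := min_reps_decomp y.
have [z [e [zE eb lz zmin]]] := demazure_min (v * a) b^-1.
have ebV : e^-1 <=B b by rewrite -[b]invgK; exact: bruhat_inv.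
have low c : c <=B b -> z <=B v * a * c^-1 by move=> /bruhat_inv; exact: zmin.
rewrite yE in way yw' ly.
(* Stripping [b] from [w a <= w1 b] and from [v a <= w1 b] may remove different factors [c] and
   [c']; the minimality of [z] handles both. *)
have [c [cb wac]] := bruhat_mul_lower way.
have [c' [c'b vac']] : exists c', c' <=B b /\ v * a * c'^-1 <=B w1.
  by apply: bruhat_mul_lower; exact: bruhat_trans vawa way.
have pz : pairs (z, w1) by split=> //=; apply: bruhat_trans vac'; exact: low.
have lez : pair_le (v, w) (z, w1).
  exists (a * c^-1); rewrite !mulgA; split=> //=; last exact: low.
  by apply: parabolicM => //; apply: parabolicV; exact: parabolic_le bJ.
have zle : pair_le (z, w1) (v * a, w').
  exists e^-1; rewrite /= zE mulgK; split.
  - exact: parabolic_le bJ.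
  - exact: bruhat_refl.
  - apply: bruhat_trans yw'; apply: (min_reps_mul w1min bJ).2 => //; exact: bruhat_refl.
have [[zv w1w]|zwNvw] := pselect ((z, w1) = (v, w)); last first.
  exists (z, w1); split=> // -[_ w1E].
  by move: ly; rewrite w1E (min_reps_mul wmin' bJ).1; lia.
have [d [c1 [x1 [[dc dx c1b x1v] [_ ld dmax]]]]] := demazure_max v b.
have vad : v * a <=B d.
  have -> : v * a = v * e^-1 by rewrite -{2}zv zE mulgK.
  by apply: dmax => //; exact: bruhat_refl.
have [dE|dN] := pselect (d = v * a).
  have x1E : x1 = v.
    apply: bruhat_anti => //; rewrite -{1}zv -[x1](mulgK b) -dx dE.
    exact/low/bruhat_refl.
  have ab : a = b by apply: (mulgI v); rewrite -dE dx x1E.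
  by move: ly; rewrite w1w -ab; lia.
rewrite w1w in yw' ly.
have wbP := min_reps_mul wmin bJ.
exists (d, w'); split.
- by split=> //=; apply: bruhat_trans yw'; rewrite dc; exact: wbP.2.
- exists c1; rewrite /= -dc; split; [exact: parabolic_le bJ|exact: bruhat_refl|].
  by apply: bruhat_trans yw'; apply: wbP.2 => //; exact: bruhat_refl.
- exists 1; rewrite !mulg1; split=> //=; [exact: parabolic1|exact: bruhat_refl].
- by move=> [_ w'E]; move: ly; rewrite w'E wbP.1; lia.
- by move=> [].
Qed.

(** Diagonal pairs will be the atoms, filling the gap above the added least element. For
    [v = w1 * b] with [w1] minimal, [b] witnesses that [(w1, w1)] lies below [(v, w)]. *)
Lemma pair_above_diag p : pairs p ->
  exists w, [/\ pairs (w, w), pair_le (w, w) p & (w, w) = p \/ (l p.1 < l p.2)%N].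
Proof.
case: p => [v w] [/= wmin vw]; have [w1 [b [w1min bJ vE]]] := min_reps_decomp v.
exists w1; split; first by split=> //; exact: bruhat_refl.
  by exists b; rewrite /= -vE; split=> //; exact: bruhat_refl.
have [vwE|lt] := bruhat_len vw; last by right.
left; suff b1 : b = 1 by rewrite -vwE vE b1 mulg1.
by apply: (min_reps_inj w1min _ bJ); rewrite -vE vwE.
Qed.

Lemma pairs_top : finite_set [set: W] ->
  exists2 w, pairs (1, w) & forall p, pairs p -> pair_le p (1, w).
Proof.
move=> /finite_seqP[S SE].
have inS x : x \in S by have : [set: W] x by []; rewrite SE.
have ex : exists n, `[< exists w, l w = n >] by exists (l 1); apply/asboolP; exists 1.
have bd n : `[< exists w, l w = n >] -> (n <= \max_(w <- S) l w)%N.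
  by move=> /asboolP[w <-]; exact: (@leq_bigmax_seq _ _ _ l).
case: (ex_maxnP ex bd) => n /asboolP[g <-] gmax.
(* The Demazure product of [g] and [x] is at least as long as [g], hence equals [g], and it
   dominates [1 * x]. *)
have gtop x : x <=B g.
  have [z [c [x1 [[zc _ _ _] [lc _ zmax]]]]] := demazure_max g x.
  have /len_eq0 c1 : l c = 0%N.
    have : (l z <= l g)%N by apply: gmax; apply/asboolP; exists z.
    by rewrite lc; lia.
  rewrite c1 mulg1 in zc; rewrite -zc -[x]mul1g.
  by apply: zmax; [exact: bruhat_1|exact: bruhat_refl].
have [w [b [wmin bJ gE]]] := min_reps_decomp g.
have pw : pairs (1, w) by split=> //; exact: bruhat_1.
exists w => // -[v w'] [/= wmin' _]; exists 1; rewrite !mulg1; split=> /=.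
- exact: parabolic1.
- exact: bruhat_1.
- have := gtop w'; rewrite gE => /bruhat_mul_lower[c [cb]].
  apply: bruhat_trans; rewrite -{1}[w']mulg1.
  have cJ := parabolicV (parabolic_le cb bJ).
  apply: (min_reps_mul wmin' cJ).2; [exact: bruhat_refl|exact: bruhat_1].
Qed.

(** * Correspondence between triples and pairs *)

Lemma IJ_pairs x u w : max_reps s J x -> WJ u -> min_reps s J w ->
  x <=B w * u <-> x * u^-1 <=B w.
Proof.
move=> xmax uJ wmin; split=> [/bruhat_mul_lower[c [cu xc]]|xu].
  (* By maximality of [x], the element [x * u^-1] has length [l x - l u], the least possible for
     [x * e] with [e <=B u^-1]; so it is the minimum [z], below [x * c^-1]. *)
  have [z [e [zE eu lx zmin]]] := demazure_min x u^-1.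
  apply: bruhat_trans xc; suff <- : z = x * u^-1 by exact/zmin/bruhat_inv.
  have lxu := max_reps_mul xmax (parabolicV uJ).
  apply: bruhat_len_eq; first exact/zmin/bruhat_refl.
  by have := bruhat_len_le eu; lia.
rewrite -[x](mulgVK u); apply: (min_reps_mul wmin uJ).2 => //; exact: bruhat_refl.
Qed.

Definition pair_of (t : W * W * W) : W * W := (t.1.1 * t.1.2^-1, t.2).

Lemma pair_of_pairs t : IJ s J t -> pairs (pair_of t).
Proof.
by case: t => [[x u] w] [xmax uJ wmin xwu]; split=> //=; apply/IJ_pairs.
Qed.

Lemma pair_of_inj t t' : IJ s J t -> IJ s J t' -> pair_of t = pair_of t' -> t = t'.
Proof.
case: t t' => [[x u] w] [[x' u'] w'] [xmax uJ _ _] [xmax' uJ' _ _] [E ->].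
have x'E : x' = x * (u^-1 * u') by rewrite mulgA E mulgVK.
have pJ : WJ (u^-1 * u') by apply: parabolicM => //; exact: parabolicV.
rewrite x'E in xmax'.
have p1 := max_reps_inj xmax xmax' pJ.
by rewrite x'E p1 mulg1 -[u'](mulVKg u) p1 mulg1.
Qed.

Lemma pair_of_surj p : finite_set WJ -> pairs p -> exists2 t, IJ s J t & pair_of t = p.
Proof.
case: p => v w fJ [/= wmin vw]; have [u uJ xmax] := max_reps_exists v fJ.
exists (v * u, u, w); last by rewrite /pair_of /= mulgK.
by split=> //; apply/IJ_pairs => //; rewrite mulgK.
Qed.

Lemma pair_of_le t t' : IJ s J t -> 
  QJ_le_triple s J t t' <-> pair_le (pair_of t) (pair_of t').
Proof.
case: t t' => [[x u] w] [[x' u'] w'] [xmax uJ wmin xwu]; split.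
  move=> [u1 [u2 [[u1J u2J uE _] [h1 h2 h3]]]]; exists u1; split=> //=.
  by rewrite -uE invgM mulgA mulgVK.
rewrite /pair_of /= => /(pair_le_add wmin)[a [aJ x'u' waw' la]].
have xE : x * (a^-1 * u)^-1 = x * u^-1 * a by rewrite invgM invgK mulgA.
have auJ : WJ (a^-1 * u) by apply: parabolicM => //; exact: parabolicV.
(* Comparing [l x] with the lengths of [x * u^-1] and [x * u^-1 * a] turns additivity of [v * a],
   for [v = x * u^-1], into additivity of [u = a * (a^-1 * u)]. *)
exists a, (a^-1 * u); rewrite xE; split; split=> //.
- by rewrite mulVKg.
- have := max_reps_mul xmax (parabolicV uJ); have := max_reps_mul xmax (parabolicV auJ).
  by rewrite xE !len_inv la; lia.
- apply: (min_reps_mul wmin aJ).2; last exact: bruhat_refl.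
  exact/IJ_pairs.
Qed.

Lemma pair_of_rank x u w : IJ s J (x, u, w) ->
  (l (w * u) - l x)%N = (l (pair_of (x, u, w)).2 - l (pair_of (x, u, w)).1)%N.
Proof.
move=> [xmax uJ wmin _] /=; rewrite (min_reps_mul wmin uJ).1.
by rewrite (max_reps_mul xmax (parabolicV uJ)) len_inv subnDr.
Qed.

Lemma pairs_below_finite q : finite_set [set p | pairs p /\ pair_le p q].
Proof.
case: q => [v' w']; apply: (@sub_finite_set _ _
    ([set x | x <=B w'] `*` [set x | x <=B w'])); last first.
  by apply: finite_setX; exact: bruhat_finite.
move=> [v w] [[/= wmin vw] [a [aJ /= _ waw']]].
have ww' : w <=B w'.
  apply: bruhat_trans waw'; rewrite -{1}[w]mulg1.
  by apply: (min_reps_mul wmin aJ).2; [exact: bruhat_refl|exact: bruhat_1].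
by split=> //=; exact: bruhat_trans ww'.
Qed.

End Coxeter.

(** * Ranked posets *)

Section RankedPoset.
Variables (T : eqType) (le : rel T) (rk : T -> nat).
Hypothesis ole : partial_order le.
Hypothesis rk_slt : forall x y, slt le x y -> (rk x < rk y)%N.
Hypothesis rk_gap : forall x y, le x y -> (rk x + 2 <= rk y)%N ->
  exists z, slt le x z && slt le z y.

Lemma slt_trans : transitive (slt le).
Proof.
have [_ anti trans] := ole; move=> y x z /andP[xy lxy] /andP[yz lyz].
apply/andP; split; last exact: trans lyz.
by apply: contraNneq xy => xz; apply/eqP/anti; rewrite lxy xz.
Qed.

Lemma slt_irr : irreflexive (slt le).
Proof. by move=> x; rewrite /slt eqxx. Qed.

(** By maximality [x] would already occur in the chain, giving a sorted list with a repetition. *)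
Lemma maximal_chain_insert (A : set T) c1 x c2 : maximal_chain le A (c1 ++ c2) ->
  A x -> ~~ sorted (slt le) (c1 ++ x :: c2).
Proof.
move=> [[_ cA] cmax] Ax; apply/negP => c'_sorted.
have := sorted_uniq slt_trans slt_irr c'_sorted.
rewrite -cat1s uniq_catCA /= => /andP[/negP xN _]; apply: xN.
apply: (cmax (c1 ++ x :: c2)); last by rewrite mem_cat mem_head orbT.
  split=> // y; rewrite mem_cat in_cons orbCA -mem_cat => /orP[/eqP->//|]; exact: cA.
by move=> y; rewrite !mem_cat in_cons => /orP[->//|->]; rewrite !orbT.
Qed.

Lemma rk_path x c : path (fun y z => rk z == (rk y).+1) x c ->
  rk (last x c) = (rk x + size c)%N.
Proof.
elim: c x => [|y c IH] x /=; rewrite ?addn0 // => /andP[/eqP yx /IH->].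
by rewrite yx addnS.
Qed.

(** A maximal chain runs from [b] to [t], and its rank rises by one at each step: a larger jump
    could be refined by [rk_gap], inside [A] by convexity. *)
Lemma maximal_chain_length (A : set T) b t c : A b -> A t ->
  (forall x, A x -> le b x && le x t) ->
  (forall x y z, A x -> A y -> le x z -> le z y -> A z) ->
  maximal_chain le A c -> chain_length c = (rk t - rk b)%N.
Proof.
move=> Ab At bt Aconv; case: c => [|x c] cmax.
  by have := maximal_chain_insert (c1 := [::]) cmax Ab.
have [[cs cA] _] := cmax; rewrite /= in cs.
have xb : x = b.
  apply/eqP; apply: contraNT (maximal_chain_insert (c1 := [::]) cmax Ab) => xb.
  have /bt/andP[bx _] : A x by apply: cA; rewrite mem_head.
  by rewrite /= /slt eq_sym xb bx.
have lastt : last x c = t.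
  apply/eqP; rewrite -[x :: c]cats0 in cmax.
  apply: contraNT (maximal_chain_insert cmax At) => xt.
  have /bt/andP[_ lt] : A (last x c) by apply: cA; rewrite mem_last.
  by rewrite /= cat_path cs /= /slt xt lt.
(* The prefix [p] keeps the whole chain in view, since its tails need not be maximal. *)
suff H q y p : maximal_chain le A (p ++ y :: q) ->
    path (fun y z => rk z == (rk y).+1) y q.
  by rewrite -lastt (rk_path (H _ _ [::] cmax)) xb addKn.
elim: q y p {x xb c cmax cs cA lastt} => //= z q IH y p cmax.
have [[cs cA] _] := cmax.
have yz : slt le y z.
  by move: cs; case: (p) => [/andP[]|? ? /=] //; rewrite cat_path /= => /and4P[].
apply/andP; split; last first.
  by apply: (IH z (rcons p y)); rewrite cat_rcons.
rewrite eqn_leq rk_slt // andbT leqNgt; apply/negP => gap.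
have [||u /andP[yu uz]] := @rk_gap y z; [by case/andP: yz|by rewrite addn2|].
have Au : A u.
  apply: (Aconv y z); [apply: cA|apply: cA|by case/andP: yu|by case/andP: uz].
    by rewrite mem_cat mem_head orbT.
  by rewrite mem_cat !in_cons eqxx !orbT.
rewrite -cat_rcons in cmax; apply/negP: (maximal_chain_insert cmax Au); rewrite negbK.
rewrite cat_rcons; move: cs; case: (p) => [|? ?] /=; first by rewrite yu uz => /andP[].
by rewrite !cat_path /= yu uz /= => /and4P[-> -> _ ->].
Qed.

Lemma covers_rk x y : covers le x y -> rk y = (rk x).+1.
Proof.
move=> /andP[xy /asboolP cov]; apply/eqP; rewrite eqn_leq rk_slt // andbT leqNgt.
apply/negP => gap; have [||z] := @rk_gap x y; [by case/andP: xy|by rewrite addn2|].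
by rewrite (negbTE (cov z)).
Qed.

Lemma unrefinable_chain_exists x y : le x y -> exists c, unrefinable_chain le x y c.
Proof.
move=> xy; suff [c' c'P] : exists c', path (covers le) x c' /\ last x c' = y.
  by exists (x :: c'), c'; case: c'P.
move: {-1}(rk y - rk x)%N (leqnn (rk y - rk x)) => n.
elim: n x y xy => [|n IH] x y xy.
  have [->|xNy] := eqVneq x y; first by exists [::].
  by have := rk_slt (x := x) (y := y); rewrite /slt xNy xy => /(_ isT); lia.
have [->|xNy] := eqVneq x y; first by exists [::].
have sxy : slt le x y by rewrite /slt xNy.
have [cov|] := boolP (covers le x y); first by exists [:: y]; rewrite /= cov.
rewrite /covers sxy /= => /asboolPn/existsNP[z /negP]; rewrite negbK => /andP[xz zy].
have := rk_slt xz; have := rk_slt zy => l1 l2 l3.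
have [[_ lxz] [_ lzy]] := (andP xz, andP zy).
have [c1 [p1 z1]] := IH x z lxz ltac:(lia).
have [c2 [p2 z2]] := IH z y lzy ltac:(lia).
by exists (c1 ++ c2); rewrite cat_path p1 last_cat z1 p2.
Qed.

Lemma has_rank_rk b x : rk b = 0%N -> le b x -> has_rank le b x (rk x).
Proof.
move=> b0 bx; split; first exact: unrefinable_chain_exists.
move=> _ [c [-> cp <-]]; rewrite (@rk_path b c) ?b0 //.
by apply: sub_path cp => y z /covers_rk ->.
Qed.

Lemma graded_ideal b t : (forall x, le b x) -> finite_set [set x | le x t] ->
  graded le [set x | le x t].
Proof.
have [refl anti trans] := ole; move=> bP fA; split=> //.
- split=> [x _|x y _ _|y x z _ _ _]; [exact: refl|exact: anti|exact: trans].
- by exists b; rewrite /= ?bP.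
- by exists t; rewrite /= ?refl.
- exists (rk t - rk b)%N => c; apply: maximal_chain_length => //=.
  + by move=> x xt; rewrite bP.
  + by move=> x y z _ yt _ zy; exact: trans zy yt.
Qed.

End RankedPoset.

(** * The poset Q^J *)

Section RankQJ.
Variables (I : Type) (W : groupType) (s : I -> W).
Hypothesis hW : coxeter_system s.
Variable J : set I.
Hypothesis hJ : finite_set (parabolic s J).

Definition QJ_pair (q : QJ s J) : option (W * W) :=
  omap (fun t : IJ s J => pair_of (val t)) q.

(** The successor reserves rank 0 for the added least element. The subtraction does not truncate, by
    [pairs_len]. *)
Definition QJ_rank (q : QJ s J) : nat :=
  if QJ_pair q is Some p then (len s p.2 - len s p.1).+1 else 0.

Lemma QJ_rank_Some (t : IJ s J) : QJ_rank (Some t) =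
  (len s (pair_of (val t)).2 - len s (pair_of (val t)).1).+1.
Proof. by []. Qed.

Lemma QJ_pair_inj : injective QJ_pair.
Proof.
move=> [t|] [t'|] //= /Some_inj E; suff -> : t = t' by [].
apply: val_inj; by apply: (pair_of_inj hW) E; exact: set_valP.
Qed.

Lemma QJ_pairP (t : IJ s J) : pairs s J (pair_of (val t)).
Proof. exact/pair_of_pairs/set_valP. Qed.

Lemma QJ_pair_surj p : pairs s J p -> exists t : IJ s J, pair_of (val t) = p.
Proof.
move=> /(pair_of_surj hW hJ)[t ht tp]; by exists (SigSub (mem_set ht)).
Qed.

Lemma QJ_leP (t t' : IJ s J) :
  reflect (pair_le s J (pair_of (val t)) (pair_of (val t'))) (QJ_le (Some t) (Some t')).
Proof.
apply: (iffP (asboolP (QJ_le_triple s J (val t) (val t'))));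
  by move=> /(pair_of_le hW _ (set_valP t)).
Qed.

Lemma QJ_le_order : partial_order (@QJ_le _ _ s J).
Proof.
split.
- by case=> [t|] //; apply/QJ_leP; exact: pair_le_refl.
- move=> [t|] [t'|] //= /andP[/QJ_leP tt' /QJ_leP t't].
  apply: QJ_pair_inj => /=; congr (Some _).
  apply: (pair_le_len_eq hW _ _ tt'); [exact: QJ_pairP..|].
  exact: (pair_le_len hW (QJ_pairP t') t't).
- move=> [t'|] [t|] [t''|] //= /QJ_leP tt' /QJ_leP t't''; apply/QJ_leP.
  exact: (pair_le_trans hW (QJ_pairP t') tt' t't'').
Qed.

Lemma pairs_len p : pairs s J p -> (len s p.1 <= len s p.2)%N.
Proof. by move=> [_ /bruhat_len_le]. Qed.

Lemma QJ_rank_slt q q' : slt (@QJ_le _ _ s J) q q' -> (QJ_rank q < QJ_rank q')%N.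
Proof.
case: q q' => [t|] [t'|] //= /andP[tNt' /QJ_leP tt']; rewrite !QJ_rank_Some ltnS ltnNge.
apply: contra tNt' => le; apply/eqP/QJ_pair_inj => /=; congr (Some _).
apply: (pair_le_len_eq hW _ _ tt'); [exact: QJ_pairP..|].
by have := pairs_len (QJ_pairP t); have := pairs_len (QJ_pairP t'); lia.
Qed.

Lemma QJ_rank_gap q q' : QJ_le q q' -> (QJ_rank q + 2 <= QJ_rank q')%N ->
  exists z, slt (@QJ_le _ _ s J) q z && slt (@QJ_le _ _ s J) z q'.
Proof.
have neq (t t' : IJ s J) : pair_of (val t) <> pair_of (val t') -> Some t != Some t'.
  by move=> h; apply/eqP => -[tt']; apply: h; rewrite tt'.
case: q q' => [t|] [t'|] // tt'; rewrite !QJ_rank_Some => gap; last first.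
  (* Above the least element: rank at least 2 means that [t'] is not diagonal, so the diagonal pair
     below it is strictly between. *)
  have [w [ww wt' wE]] := pair_above_diag hW (QJ_pairP t').
  have [z zE] := QJ_pair_surj ww; exists (Some z); rewrite /slt andTb.
  rewrite -zE in wt' wE; apply/andP; split; last exact/QJ_leP.
  by apply: neq => E; move: gap; rewrite -E zE subnn.
have [|r [rp tr rt' rNt rNt']] :=
    pair_between hW (QJ_pairP t) (QJ_pairP t') (QJ_leP _ _ tt').
  by have := pairs_len (QJ_pairP t); have := pairs_len (QJ_pairP t'); lia.
have [z zE] := QJ_pair_surj rp; exists (Some z); rewrite -zE in tr rt' rNt rNt'.
apply/andP; split; apply/andP; split; try exact/QJ_leP; apply: neq => // E.
exact: rNt.
Qed.

Lemma QJ_ideal_finite q : finite_set [set p : QJ s J | QJ_le p q].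
Proof.
case: q => [t|]; last by apply: (@sub_finite_set _ _ [set None]) => // -[].
apply: (@sub_finite_set _ _ (QJ_pair @^-1` (None |` Some @` [set p |
    pairs s J p /\ pair_le s J p (pair_of (val t))]))).
  move=> [t'|] /=; last by left.
  move=> /QJ_leP t't; right; exists (pair_of (val t')) => //; split=> //; exact: QJ_pairP.
apply: finite_preimage; first by move=> x y _ _; exact: QJ_pair_inj.
by rewrite finite_setU; split=> //; apply: finite_image; exact: pairs_below_finite.
Qed.

End RankQJ.

Theorem corollary6p4 (I : Type) (W : groupType) (s : I -> W)
    (hW : coxeter_system s) (J : set I) (hJ : finite_set (parabolic s J)) :
  [/\ partial_order (@QJ_le _ _ s J),
      finite_set [set: W] -> graded (@QJ_le _ _ s J) [set: QJ s J],
      forall q : QJ s J, graded (@QJ_le _ _ s J) [set p | QJ_le p q]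
    & forall t : IJ s J, let: (x, u, w) := val t in
        has_rank (@QJ_le _ _ s J) None (Some t) (len s (w * u) - len s x).+1].
Proof.
have order := QJ_le_order hW J.
have ideal (q : QJ s J) : graded (@QJ_le _ _ s J) [set p | QJ_le p q].
  apply: (graded_ideal order (@QJ_rank_slt _ _ _ hW J)
    (@QJ_rank_gap _ _ _ hW J hJ) (b := None)) => //.
  exact: QJ_ideal_finite.
split=> // [fW|t].
  (* For finite [W] the whole poset is the principal ideal of the top pair [(1, w)]. *)
  have [w w1 wtop] := pairs_top hW J fW.
  have [t tE] := QJ_pair_surj hW hJ w1.
  suff -> : [set: QJ s J] = [set p | QJ_le p (Some t)] by exact: ideal.
  apply/seteqP; split=> // -[t'|] // _; apply/(QJ_leP hW).
  by rewrite tE; apply: wtop; exact: (QJ_pairP hW).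
have rank_t : has_rank (@QJ_le _ _ s J) None (Some t) (QJ_rank (Some t)).
  exact: (has_rank_rk (@QJ_rank_slt _ _ _ hW J) (@QJ_rank_gap _ _ _ hW J hJ)).
case tE: (val t) => [[x u] w]; have ht : IJ s J (x, u, w) by rewrite -tE; exact: set_valP.
by rewrite (pair_of_rank hW ht) -tE.
Qed.
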